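(* Let $\Psi:[0,\ell(I)[\,\to\mathbb{R}_+$ and assume that the map $t\mapsto\Psi(t)/t$ is locally integrable on $[0,\ell(I)[$, and let $\Phi:[0,\ell(I)[\,\to\mathbb{R}_+$ satisfy $$\Phi(u)=\Psi(u)+\int_0^u\frac{\Psi(t)}{t}\,dt\qquad(u\in\,]0,\ell(I)[).$$ If $f:I\to\mathbb{R}$ is an upper semicontinuous solution of $$f(u)\le\frac{1}{v-u}\int_u^v f+\Psi(v-u)\qquad(u,v\in I,\ u<v),$$ then $f$ is $\Phi$-monotone on $I$.
   Context: $I$ is a nonempty open real interval and $\ell(I)\in\,]0,\infty]$ is its length; $\mathbb{R}_+=[0,\infty[$. A function on an interval is locally integrable if it has a finite Lebesgue integral over every compact subinterval of its domain (the value of $\Psi(t)/t$ at $t=0$ is irrelevant). The value $\Phi(0)\ge0$ is arbitrary. $f:I\to\mathbb{R}$ is $\Phi$-monotone if $f(x)\le f(y)+\Phi(y-x)$ for all $x,y\in I$ with $x\le y$. The integral of the upper semicontinuous function $f$ over $[u,v]$ is the Lebesgue integral, which exists in $[-\infty,\infty[$ since $f$ is bounded above on compact intervals. *)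

(* Defs.v *)
From HB Require Import structures.
From mathcomp Require Import all_boot all_order all_algebra.
From mathcomp Require Import all_classical all_reals all_analysis.

Set Implicit Arguments.
Unset Strict Implicit.
Unset Printing Implicit Defensive.

Import Order.TTheory GRing.Theory Num.Theory.
Import numFieldNormedType.Exports.

Local Open Scope classical_set_scope.
Local Open Scope ring_scope.

(* Functions on an interval are total functions R -> R, of which only the
   values on the interval are constrained or used. *)

Definition open_interval (R : realType) (I : set R) : Prop :=
  [/\ is_interval I, open I & I !=set0].

Definition itv_length (R : realType) (I : set R) : \bar R :=
  (ereal_sup (EFin @` I) - ereal_inf (EFin @` I))%E.

(* The domain [0, l[, where l may be +oo. *)
Definition co_itv (R : realType) (l : \bar R) : set R :=
  [set t | 0 <= t /\ (t%:E < l)%E].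

(* The completed measure makes measurability Lebesgue measurability, whereas
   [lebesgue_measure] lives on the Borel sigma-algebra. *)
Definition lebesgue_integrable_on (R : realType) (g : R -> R) (a b : R) : Prop :=
  (@completed_lebesgue_measure R).-integrable `[a, b] (fun t => (g t)%:E).

Definition lebesgue_int (R : realType) (g : R -> R) (a b : R) : \bar R :=
  (\int[@completed_lebesgue_measure R]_(t in `[a, b]) (g t)%:E)%E.

Definition locally_integrable_on (R : realType) (D : set R) (g : R -> R) : Prop :=
  forall a b : R, a <= b -> `[a, b] `<=` D -> lebesgue_integrable_on g a b.

Definition upper_semicontinuous_on (R : realType) (I : set R) (f : R -> R) : Prop :=
  forall x, I x -> forall r, f x < r ->
    \forall y \near within I (nbhs x), f y < r.

Definition monotone_up_to (R : realType) (I : set R) (Phi f : R -> R) : Prop :=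
  forall x y, I x -> I y -> x <= y -> f x <= f y + Phi (y - x).

(* Main.v *)
Require Import Defs.
From HB Require Import structures.
From mathcomp Require Import all_boot all_order all_algebra.
From mathcomp Require Import all_classical all_reals all_analysis.
From mathcomp Require Import measurable_realfun ring lra.

Import Order.TTheory GRing.Theory Num.Theory.
Import numFieldNormedType.Exports.

Local Open Scope classical_set_scope.
Local Open Scope ring_scope.

(** Put L := y - x, let C bound f above on [x, y], and let
    k s := C - f (y - s) >= 0 on [0, L] and K t := \int_0^t k.  The hypothesis
    reads K t / t <= k t + Psi t.  Formally (K t / t)' = k t / t - K t / t^2
    >= - Psi t / t, so that K e / e <= K L / L + \int_e^L Psi t / t; since k is
    merely measurable, the fundamental theorem of calculus is replaced by
    Tonelli's theorem.  Upper semicontinuity of f at y bounds K e / e from below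
    by C - f y - o(1) as e -> 0, and the hypothesis at t = L bounds f x above by
    C - K L / L + Psi L. *)

(** * Passage between the completed and the Borel Lebesgue measure *)

Local Notation leb := (@lebesgue_measure _).
Local Notation cleb := (@completed_lebesgue_measure _).

Lemma completed_measurable (R : realType) (A : set R) :
  measurable A -> (@wlength R idfun)^*%mu.-cara.-measurable A.
Proof. exact: sub_caratheodory. Qed.

Lemma measurable_fun_completed d (U : measurableType d) (R : realType)
    (D : set R) (g : R -> U) :
  measurable D -> measurable_fun D g ->
  measurable_fun (D : set (caratheodory_type (@wlength R idfun)^*%mu)) g.
Proof.
by move=> mD mg _ Y mY; apply: completed_measurable; exact: mg.
Qed.

(** The pushforward of the completed measure along [phi] is a measure on the Borel sets that agrees
    with [leb] by hypothesis. It is used for the identity and for reflections: the theorem speaks of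
    completed integrals, Tonelli's theorem is applied to Borel ones. *)
Lemma ge0_integral_completed_comp (R : realType) (phi : R -> R) (D : set R)
    (g : R -> \bar R) :
  measurable_fun setT phi ->
  (forall A : set R, measurable A -> leb (phi @^-1` A) = leb A) ->
  measurable D -> measurable_fun D g -> (forall x, D x -> (0 <= g x)%E) ->
  (\int[cleb]_(x in phi @^-1` D) g (phi x) = \int[leb]_(x in D) g x)%E.
Proof.
move=> mphi phiE mD mg g0.
pose T := caratheodory_type (@wlength R idfun)^*%mu.
have mphi' : measurable_fun [set: T] (phi : T -> measurableTypeR R).
  exact: measurable_fun_completed.
pose mphi_mixin := isMeasurableFun.Build _ _ T (measurableTypeR R) phi mphi'.
pose phi_pack : {mfun T >-> measurableTypeR R} :=
  HB.pack (phi : T -> measurableTypeR R) mphi_mixin.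
rewrite -(@ge0_integral_pushforward _ _ _ _ _ _ mphi' cleb D g)//.
- apply: (eq_measure_integral leb
    (m1 := pushforward cleb phi_pack)) => A mA _; exact: phiE.
- by move=> x /set_mem; exact: g0.
Qed.

Lemma ge0_integral_completed (R : realType) (D : set R) (g : R -> \bar R) :
  measurable D -> measurable_fun D g -> (forall x, D x -> (0 <= g x)%E) ->
  (\int[cleb]_(x in D) g x = \int[leb]_(x in D) g x)%E.
Proof.
move=> mD mg g0; apply: (ge0_integral_completed_comp _ idfun) => //.
exact: measurable_id.
Qed.

(** By uniqueness of the measure only half-open intervals matter: the preimage of []a, b]] is [[c -
    b, c - a[], of the same length. *)
Lemma lebesgue_measure_reflect (R : realType) (c : R) (A : set R) :
  measurable A -> leb ((fun x => c - x) @^-1` A) = leb A.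
Proof.
move=> mA; rewrite -[LHS]/(pushforward leb
  ((fun x => c - x) : _ -> measurableTypeR R) A).
apply/esym/lebesgue_measure_unique => //=.
  by apply: measurable_funB.
move=> mc _ [[a b] _ <-].
rewrite /pushforward/= (_ : _ @^-1` _ = `[c - b, c - a[%classic).
  rewrite !lebesgue_measure_itv/= !lte_fin ltrD2l ltrN2 -!EFinB.
  by case: ifP => // _; congr (_%:E); ring.
apply/seteqP; split => x /=; rewrite !in_itv/= => /andP[h1 h2].
  by rewrite lerBlDr -lerBlDl h2 ltrBrDl -ltrBrDr h1.
by rewrite ltrBrDl -ltrBrDr h2 lerBlDr -lerBlDl h1.
Qed.

Lemma ge0_integral_completed_reflect (R : realType) (c a b : R) (g : R -> R) :
  measurable_fun `[c - b, c - a] g ->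
  (forall x, `[c - b, c - a]%classic x -> 0 <= g x) ->
  (\int[cleb]_(x in `[(c - b)%R, (c - a)%R]) (g x)%:E =
   \int[leb]_(s in `[a, b]) (g (c - s)%R)%:E)%E.
Proof.
move=> mg g0.
have memE x : (c - x \in `[c - b, c - a]) = (x \in `[a, b]).
  by rewrite !in_itv/= !lerD2l !lerN2 andbC.
have preE : (fun x => c - x) @^-1` `[a, b] = `[c - b, c - a]%classic.
  by apply/seteqP; split => x /=; rewrite -memE subKr.
rewrite -(@ge0_integral_completed_comp R (fun x => c - x) `[a, b]
  (fun s => (g (c - s))%:E)) //.
- rewrite preE; apply: eq_integral => x _ /=.
  by rewrite subKr.
- by apply: measurable_funB.
- exact: lebesgue_measure_reflect.
- apply/measurable_EFinP.
  apply: (@measurable_comp _ _ _ _ _ _ `[c - b, c - a] g `[a, b] (fun s => c - s)) => //.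
  + by move=> _ [x /= xab <-]; rewrite memE.
  + by apply: measurable_funB.
- by move=> x /= xab; rewrite lee_fin g0//= memE.
Qed.

(** * Tonelli's theorem and the mean of a primitive *)

(** Both sides integrate [w t * k s] over the triangle [0 <= s <= t], in the two possible orders. *)
Lemma integral_triangle (R : realType) (w k : R -> R) :
  measurable_fun setT w -> measurable_fun setT k ->
  (forall t, 0 <= w t) -> (forall s, 0 <= k s) ->
  (\int[leb]_t ((w t)%:E * \int[leb]_(s in `[0%R, t]) (k s)%:E) =
   \int[leb]_(s in `[0%R, +oo[) ((k s)%:E * \int[leb]_(t in `[s, +oo[) (w t)%:E))%E.
Proof.
move=> mw mk w0 k0.
pose F (z : R * R) : R :=
  if (0 <= z.2) && (z.2 <= z.1) then w z.1 * k z.2 else 0.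
have F0 z : (0 <= (F z)%:E)%E by rewrite lee_fin /F; case: ifP => // _; rewrite mulr_ge0.
have mF : measurable_fun setT (EFin \o F).
  apply/measurable_EFinP; apply: measurable_fun_ifT => //.
    by apply: measurable_and; apply: measurable_fun_ler.
  by apply: measurable_funM; apply: measurableT_comp.
transitivity (\int[leb]_t \int[leb]_s (EFin \o F) (t, s))%E.
  apply: eq_integral => t _; rewrite -ge0_integralZl//=; last first.
  - by rewrite lee_fin.
  - by move=> s _; rewrite lee_fin.
  - by apply/measurable_EFinP; apply: measurable_funTS.
  rewrite integral_mkcond; apply: eq_integral => s _.
  rewrite /F patchE mem_setE in_itv/= -EFinM.
  by case: ifP.
rewrite fubini_tonelli// [RHS]integral_mkcond; apply: eq_integral => s _.
rewrite patchE mem_setE in_itv/= andbT; case: ifPn => s0; last first.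
  by apply: integral0_eq => t _ /=; rewrite /F/= (negbTE s0).
rewrite -ge0_integralZl//=; last first.
- by rewrite lee_fin.
- by move=> t _; rewrite lee_fin.
- by apply/measurable_EFinP; apply: measurable_funTS.
rewrite [RHS]integral_mkcond; apply: eq_integral => t _.
rewrite /F patchE mem_setE in_itv/= s0/= andbT -EFinM mulrC.
by case: ifP.
Qed.

Lemma continuous_within_Vsqr (R : realType) (a b : R) : 0 < a ->
  {within `[a, b], continuous (fun t : R => (t ^+ 2)^-1)}.
Proof.
move=> a0; have cV (t : R) : t != 0 -> {for t, continuous (fun u : R => (u ^+ 2)^-1)}.
  move=> t0; apply: (@continuousV R R (fun u => u ^+ 2)).
    by rewrite expf_neq0.
  exact: exprn_continuous.
apply: continuous_in_subspaceT => t /set_mem/=.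
rewrite in_itv/= => /andP[at_ _].
by apply: cV; rewrite gt_eqF// (lt_le_trans a0).
Qed.

Lemma integral_Vsqr (R : realType) (a b : R) : 0 < a -> a <= b ->
  (\int[leb]_(t in `[a, b]) ((t ^+ 2)^-1)%R%:E = (a^-1 - b^-1)%:E)%E.
Proof.
move=> a0; rewrite le_eqVlt => /predU1P[<-|ab].
  by rewrite subrr set_itv1 integral_set1.
have b0 := lt_trans a0 ab.
have dV (x : R) : 0 < x -> is_derive x 1 (fun t : R => - t^-1) ((x ^+ 2)^-1).
  move=> x0; have xn0 : x != 0 by rewrite gt_eqF.
  have dV := @is_deriveV _ id x 1 1 xn0 (is_derive_id x 1).
  by have := is_deriveN dV; rewrite scaleNr opprK [_ *: _]mulr1.
have cV (x : R) : 0 < x -> {for x, continuous (fun t : R => - t^-1)}.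
  move=> x0; apply: continuousN; apply: (@continuousV _ _ id); last exact: cvg_id.
  by rewrite gt_eqF.
rewrite (@continuous_FTC2 _ _ (fun t => - t^-1)%R)//.
- by rewrite -EFinB opprK addrC.
- exact: continuous_within_Vsqr.
- split.
  + move=> x; rewrite in_itv/= => /andP[ax _].
    by have [] := dV x (lt_trans a0 ax).
  + by apply: cvg_at_right_filter; exact: cV.
  + by apply: cvg_at_left_filter; exact: cV.
- move=> x; rewrite in_itv/= => /andP[ax _]; rewrite derive1E.
  by have [_] := dV x (lt_trans a0 ax).
Qed.

(* With K t := \int_0^t k, this integrates (K t / t)' = k t / t - K t / t^2 over
   [e, L], rearranged so that it holds in [0, +oo]. *)
Lemma integral_mean_by_parts (R : realType) (k : R -> R) (e L : R) :
  0 < e -> e <= L -> measurable_fun setT k -> (forall s, 0 <= k s) ->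
  (\int[leb]_(t in `[e, L]) (((t ^+ 2)^-1)%R%:E * \int[leb]_(s in `[0%R, t]) (k s)%:E)
     + (L^-1)%:E * \int[leb]_(s in `[0%R, L]) (k s)%:E =
   (e^-1)%:E * \int[leb]_(s in `[0%R, e]) (k s)%:E
     + \int[leb]_(s in `]e, L]) (k s / s)%R%:E)%E.
Proof.
move=> e0 eL mk k0; have L0 := lt_le_trans e0 eL.
(* Extending by 0 outside [[e, L]] turns the first integral into one over the whole line, as
   [integral_triangle] requires. *)
pose w := (fun t : R => (t ^+ 2)^-1) \_ `[e, L].
have mw : measurable_fun setT w.
  apply/(measurable_restrictT _ _).1 => //.
  apply: subspace_continuous_measurable_fun => //.
  exact: continuous_within_Vsqr.
have w0 t : 0 <= w t.
  by rewrite /w patchE; case: ifP => // _; rewrite invr_ge0 sqr_ge0.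
(* This is the weight that [k s] receives after the exchange: only the [t] between [Num.max s e] and
   [L] count, hence none when [s > L]. *)
have WE (s : R) : 0 <= s -> (\int[leb]_(t in `[s, +oo[) (w t)%:E =
    if (s <= L)%R then ((Num.max s e)^-1 - L^-1)%R%:E else 0)%E.
  move=> s0.
  have -> : (\int[leb]_(t in `[s, +oo[) (w t)%:E =
      \int[leb]_(t in `[(Num.max s e)%R, L]) ((t ^+ 2)^-1)%R%:E)%E.
    rewrite integral_mkcond [RHS]integral_mkcond; apply: eq_integral => t _.
    rewrite !patchE !mem_setE !in_itv/= andbT ge_max /w patchE mem_setE in_itv/=.
    by case: (s <= t) => //=; case: ifP.
  case: ifPn => sL.
    by rewrite integral_Vsqr// ?lt_max ?e0 ?orbT// ge_max sL.
  rewrite set_itv_ge ?integral_set0// bnd_simp -ltNge lt_max.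
  by rewrite ltNge sL.
have -> : (\int[leb]_(t in `[e, L])
      (((t ^+ 2)^-1)%R%:E * \int[leb]_(s in `[0%R, t]) (k s)%:E) =
    \int[leb]_(s in `[0%R, L]) (k s * ((Num.max s e)^-1 - L^-1))%R%:E)%E.
  transitivity (\int[leb]_t ((w t)%:E * \int[leb]_(s in `[0%R, t]) (k s)%:E))%E.
    rewrite integral_mkcond; apply: eq_integral => t _.
    by rewrite /w !patchE; case: ifP => // _; rewrite mul0e.
  rewrite integral_triangle// integral_mkcond [RHS]integral_mkcond.
  apply: eq_integral => s _; rewrite !patchE !mem_setE !in_itv/= andbT.
  case: ifPn => //= s0; rewrite WE//.
  by case: ifP => //; rewrite mule0.
have mmax (D : set R) : measurable_fun D (fun s : R => (Num.max s e)^-1).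
  apply: measurable_funTS; apply: continuous_measurable_fun => x.
  apply: (@continuousV _ _ (fun s => Num.max s e)).
    by rewrite gt_eqF// lt_max e0 orbT.
  by apply: (@continuous_max _ _ id (cst e)); [exact: cvg_id|exact: cvg_cst].
rewrite -ge0_integralZl_EFin//; last first.
- by rewrite invr_ge0 ltW.
- by apply/measurable_EFinP; apply: measurable_funTS.
- by move=> s _; rewrite lee_fin.
rewrite -ge0_integralD//; last first.
- by apply/measurable_EFinP; apply: measurable_funM => //; apply: measurable_funTS.
- by move=> s _; rewrite mule_ge0// lee_fin// invr_ge0 ltW.
- apply/measurable_EFinP; apply: measurable_funM.
    by apply: measurable_funTS.
  by apply: measurable_funB => //; exact: mmax.
- move=> s /=; rewrite in_itv/= => /andP[_ sL]; rewrite lee_fin mulr_ge0// subr_ge0.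
  by rewrite lef_pV2// ?posrE// ?lt_max ?e0 ?orbT// ge_max sL.
(* The second summand cancels the [- L^-1] in the weight. The remaining factor [(Num.max s e)^-1] is
   [e^-1] up to [e] and [s^-1] beyond, so the integral is split at [e]. *)
have -> : (\int[leb]_(s in `[0%R, L])
      ((k s * ((Num.max s e)^-1 - L^-1))%R%:E + (L^-1)%:E * (k s)%:E) =
    \int[leb]_(s in `[0%R, L]) (k s / Num.max s e)%R%:E)%E.
  by apply: eq_integral => s _; rewrite -EFinM -EFinD mulrBr (mulrC L^-1) subrK.
rewrite (@itv_bndbnd_setU _ _ _ (BRight e)) ?bnd_simp ?(ltW e0)//.
rewrite ge0_integral_setU//=; first last.
- apply/disj_setPS => s [] /=; rewrite !in_itv/= => /andP[_ se] /andP[es _].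
  by move: es; rewrite ltNge se.
- move=> s _; rewrite lee_fin mulr_ge0// invr_ge0 le_max (ltW e0) orbT//.
- apply/measurable_EFinP; apply: measurable_funM; last exact: mmax.
  by apply: measurable_funTS.
congr (_ + _)%E.
- rewrite -ge0_integralZl_EFin//; last first.
  + by rewrite invr_ge0 ltW.
  + by apply/measurable_EFinP; apply: measurable_funTS.
  + by move=> s _; rewrite lee_fin.
  apply: eq_integral => s; rewrite mem_setE in_itv/= => /andP[_ se].
  by rewrite (max_idPr se) mulrC EFinM.
- apply: eq_integral => s; rewrite mem_setE in_itv/= => /andP[es _].
  by rewrite (max_idPl (ltW es)).
Qed.

(** The primitive is the integral over sections of a nonnegative Borel function on the plane, whose
    measurability is part of Tonelli's theorem. *)
Lemma measurable_primitive (R : realType) (k : R -> R) :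
  measurable_fun setT k -> (forall s, 0 <= k s) ->
  measurable_fun setT (fun t : R => \int[leb]_(s in `[0%R, t]) (k s)%:E)%E.
Proof.
move=> mk k0.
pose F (z : R * R) : R := if (0 <= z.2) && (z.2 <= z.1) then k z.2 else 0.
have mF : measurable_fun setT (EFin \o F).
  apply/measurable_EFinP; apply: measurable_fun_ifT => //.
    by apply: measurable_and; apply: measurable_fun_ler.
  by apply: measurableT_comp.
have F0 z : (0 <= (EFin \o F) z)%E by rewrite lee_fin /F; case: ifP.
rewrite (_ : (fun _ => _) = fubini_F leb (EFin \o F)).
  exact: measurable_fun_fubini_tonelli_F.
apply/funext => t; rewrite /fubini_F/= integral_mkcond; apply: eq_integral => s _.
by rewrite patchE mem_setE in_itv /F/=; case: ifP.
Qed.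

(** The last hypothesis divided by [t] is integrated over [[e, L]] and inserted into
    [integral_mean_by_parts]; the integral of [k s / s] then cancels, and [c] bounds the mean over
    [[0, e]] from below. *)
Lemma le_mean_add_integral (R : realType) (k psi : R -> R) (c e L : R) :
  0 < e -> e <= L -> measurable_fun setT k -> (forall s, 0 <= k s) ->
  (forall s, 0 <= s -> s <= e -> c <= k s) ->
  (forall t, 0 <= t -> t <= L -> 0 <= psi t) ->
  lebesgue_integrable_on (fun t => psi t / t) 0 L ->
  (\int[leb]_(s in `[0%R, L]) (k s)%:E < +oo)%E ->
  (forall t, 0 < t -> t <= L ->
    ((t^-1)%:E * \int[leb]_(s in `[0%R, t]) (k s)%:E <= (k t + psi t)%R%:E)%E) ->
  (c%:E <= (L^-1)%:E * \int[leb]_(s in `[0%R, L]) (k s)%:E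
     + lebesgue_int (fun t => (psi t / t)%R) 0%R L)%E.
Proof.
move=> e0 eL mk k0 ck psi0 psii KL Kle; have L0 := lt_le_trans e0 eL.
have mkD (D : set R) : measurable_fun D (EFin \o k).
  by apply/measurable_EFinP; exact: measurable_funTS.
have mK := measurable_primitive _ _ mk k0.
set K := (fun t : R => _) in mK.
have K0 t : (0 <= K t)%E by apply: integral_ge0 => s _; rewrite lee_fin.
have mV D : measurable D -> D `<=` `[e, L]%classic ->
    measurable_fun D (fun s : R => s^-1).
  move=> mD DeL; apply: (measurable_funS (E := `[e, L])) => //.
  apply: subspace_continuous_measurable_fun => //.
  apply: continuous_in_subspaceT => t /set_mem/=.
  rewrite in_itv/= => /andP[et _].
  by apply: inv_continuous; rewrite gt_eqF// (lt_le_trans e0).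
have mkV D : measurable D -> D `<=` `[e, L]%classic ->
    measurable_fun D (fun s => (k s / s)%R%:E).
  move=> mD DeL; apply/measurable_EFinP; apply: measurable_funM.
    exact: measurable_funTS.
  exact: mV.
have mkVeL := mkV _ (measurable_itv `[e, L]) (@subset_refl _ _).
have kV0 s : e <= s -> (0 <= (k s / s)%R%:E)%E.
  by move=> es; rewrite lee_fin mulr_ge0// invr_ge0 (le_trans (ltW e0)).
have oceL : `]e, L]%classic `<=` (`[e, L]%classic : set R).
  by apply: subset_itvr; rewrite bnd_simp.
have ooeL : `]e, L[%classic `<=` (`[e, L]%classic : set R).
  by move=> s /=; rewrite !in_itv/= => /andP[/ltW -> /ltW ->].
have kVE : (\int[leb]_(s in `]e, L]) (k s / s)%R%:E =
    \int[leb]_(s in `[e, L]) (k s / s)%R%:E)%E.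
  rewrite (integral_itv_bndoo false false); last exact: mkV.
  by rewrite (integral_itv_bndoo true false)//; exact: mkV.
(* Finiteness permits the final cancellation. It holds because [s^-1 <= e^-1] on [[e, L]] and [K L]
   is finite. *)
have A_fin : (\int[leb]_(s in `[e, L]) (k s / s)%R%:E)%E \is a fin_num.
  rewrite ge0_fin_numE; last first.
    by apply: integral_ge0 => s /=; rewrite in_itv/= => /andP[es _]; exact: kV0.
  apply: (@le_lt_trans _ _ ((e^-1)%:E * K L)%E); last first.
    by rewrite lte_mul_pinfty// lee_fin invr_ge0 ltW.
  rewrite /K -ge0_integralZl_EFin//; last first.
  - by rewrite invr_ge0 ltW.
  - exact: mkD.
  - by move=> s _; rewrite lee_fin.
  apply: (@le_trans _ _ (\int[leb]_(x in `[e, L]) ((e^-1)%:E * (k x)%:E))%E).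
    apply: ge0_le_integral => //.
    - by move=> s /=; rewrite in_itv/= => /andP[es _]; exact: kV0.
    - by apply: measurable_funeM; exact: mkD.
    - move=> s /=; rewrite in_itv/= => /andP[es _].
      rewrite -EFinM lee_fin mulrC ler_wpM2r// lef_pV2// posrE//.
      exact: lt_le_trans es.
  apply: ge0_subset_integral => //.
  - by apply: measurable_funeM; exact: mkD.
  - by move=> s _; rewrite mule_ge0// lee_fin// invr_ge0 ltW.
  - by apply: subset_itvr; rewrite bnd_simp ltW.
have := integral_mean_by_parts _ k _ _ e0 eL mk k0; rewrite -!/(K _) kVE.
set T := (\int[leb]_(t in _) (_ * _))%E; set A := (X in (_ = _ + X)%E) => idK.
have TleA : (T <= A + lebesgue_int (fun t => (psi t / t)%R) 0%R L)%E.
  have mT : measurable_fun `[e, L] (fun t : R => ((t ^+ 2)^-1)%R%:E * K t)%E.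
    apply: emeasurable_funM; last exact: measurable_funTS.
    apply/measurable_EFinP; apply: subspace_continuous_measurable_fun => //.
    exact: continuous_within_Vsqr.
  have T0 t : (0 <= ((t ^+ 2)^-1)%R%:E * K t)%E.
    by rewrite mule_ge0// lee_fin invr_ge0 sqr_ge0.
  have psiV0 t : 0 <= t -> t <= L -> (0 <= (psi t / t)%R%:E)%E.
    by move=> t0 tL; rewrite lee_fin mulr_ge0 ?invr_ge0// psi0.
  have /integrableP[mpsi _] := psii.
  have e0L : `[e, L]%classic `<=` (`[0, L]%classic : set R).
    by apply: subset_itvr; rewrite bnd_simp ltW.
  have meL := completed_measurable R _ (measurable_itv `[e, L]).
  have m0L := completed_measurable R _ (measurable_itv `[0, L]).
  (* The comparison takes place in the completed measure, since [psi t / t] is only Lebesgue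
     measurable. *)
  rewrite /T -ge0_integral_completed// /A -ge0_integral_completed//; last first.
    by move=> s /=; rewrite in_itv/= => /andP[es _]; exact: kV0.
  apply: (@le_trans _ _ (\int[cleb]_(x in `[e, L]) (k x / x)%R%:E +
      \int[cleb]_(x in `[e, L]) (psi x / x)%R%:E)%E); last first.
    rewrite leeD2l//; apply: ge0_subset_integral => //.
    by move=> t /=; rewrite in_itv/= => /andP[]; exact: psiV0.
  have mpsi' := measurable_funS m0L e0L mpsi.
  have mkV' := measurable_fun_completed _ _ _ _ _ (measurable_itv `[e, L]) mkVeL.
  have kV0' s : `[e, L]%classic s -> (0 <= (k s / s)%:E)%E.
    by rewrite /= in_itv/= => /andP[es _]; exact: kV0.
  have psiV0' s : `[e, L]%classic s -> (0 <= (psi s / s)%:E)%E.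
    by move=> /e0L/=; rewrite in_itv/= => /andP[]; exact: psiV0.
  have <- := ge0_integralD cleb meL kV0' mkV' psiV0' mpsi'.
  have mT' := measurable_fun_completed _ _ _ _ _ (measurable_itv `[e, L]) mT.
  have := ge0_le_integral cleb meL (fun t _ => T0 t) mT'
    (emeasurable_funD mkV' mpsi').
  apply => t; rewrite /= in_itv/= => /andP[et tL].
  have t0 := lt_le_trans e0 et.
  have tV0 : (0 <= (t^-1)%:E)%E by rewrite lee_fin invr_ge0 ltW.
  have := lee_wpmul2l tV0 (Kle t t0 tL).
  by rewrite muleA -!EFinM -invfM -expr2 mulrDr ![t^-1 * _]mulrC EFinD.
have /le_trans : (c%:E <= (e^-1)%:E * K e)%E.
  (* Monotonicity of the integral is applied to nonnegative functions, so a constant [c <= 0] is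
     treated apart, by [K e >= 0]. *)
  have [c0|c0] := leP c 0.
    by apply: (@le_trans _ _ 0%E) => //; rewrite mule_ge0// lee_fin invr_ge0 ltW.
  have -> : (c%:E = (e^-1)%:E * \int[leb]_(s in `[0%R, e]) (cst c%:E) s)%E.
    rewrite integral_cst//= lebesgue_measure_itv/= lte_fin e0 oppr0 adde0.
    by rewrite -!EFinM mulrCA mulVf ?mulr1// gt_eqF.
  rewrite lee_wpmul2l ?lee_fin ?invr_ge0 ?(ltW e0)//.
  apply: ge0_le_integral => //.
  - by move=> s _; rewrite lee_fin ltW.
  - exact: mkD.
  - by move=> s /=; rewrite in_itv/= => /andP[s0 se]; rewrite lee_fin ck.
apply; rewrite -(leeD2rE _ _ A_fin) -idK addeC -addeA leeD2l//.
by rewrite addeC.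
Qed.

(** * Integrability of functions bounded above, and upper semicontinuity *)

(** The positive part is at most [Num.max C 0] on a set of finite measure. An infinite integral of
    the negative part would then make the whole integral [-oo]. *)
Lemma integrable_le_cst d (T : measurableType d) (R : realType)
    (mu : {measure set T -> \bar R}) (D : set T) (g : T -> R) (C : R) :
  measurable D -> (mu D < +oo)%E -> measurable_fun D g ->
  (forall x, D x -> g x <= C) -> (-oo < \int[mu]_(x in D) (g x)%:E)%E ->
  mu.-integrable D (EFin \o g).
Proof.
move=> mD muD mg gC gNy.
have mEg : measurable_fun D (EFin \o g) by exact/measurable_EFinP.
have pos_fin : (\int[mu]_(x in D) (EFin \o g)^\+ x < +oo)%E.
  apply: (@le_lt_trans _ _ (\int[mu]_(x in D) (cst (Num.max C 0)%:E) x)%E).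
    apply: ge0_le_integral => //.
    - exact: measurable_funepos.
    - move=> x Dx; rewrite funeposE -EFin_max lee_fin ge_max !le_max lexx orbT.
      by rewrite (gC _ Dx).
  by rewrite integral_cst// lte_mul_pinfty// lee_fin le_max lexx orbT.
apply/integrableP; split => //.
rewrite -[X in integral _ _ X]/(abse \o (EFin \o g)) fune_abse.
rewrite ge0_integralD//; [|exact: measurable_funepos|exact: measurable_funeneg].
apply: lte_add_pinfty => //.
rewrite ltey; apply/eqP => negE; move: gNy; rewrite integralE negE.
by move: pos_fin; case: (\int[mu]_(x in D) _)%E.
Qed.

Lemma usc_bounded_above (R : realType) (I : set R) (f : R -> R) (x y : R) :
  upper_semicontinuous_on I f -> `[x, y] `<=` I ->
  exists C : R, forall t, t \in `[x, y] -> f t <= C.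
Proof.
move=> fusc xyI.
have /compact_near_coveringP/near_covering_withinP cov := @segment_compact R x y.
have fN : \forall C \near +oo%R, `[x, y]%classic `<=` [set t | f t <= C].
  (* Compactness in its near-covering form, with [C] tending to [+oo] as parameter: near each [t]
     the bound [f t + 1] works, and the covering makes it uniform. *)
  apply: (cov R +oo%R (fun C t => f t <= C)) => t xyt.
  have It := xyI _ xyt.
  have := fusc t It (f t + 1); rewrite ltrDl ltr01 => /(_ isT) ft.
  exists ([set t' | I t' -> f t' < f t + 1], [set C | f t + 1 <= C]) => /=.
    by split; [exact: ft|apply: nbhs_pinfty_ge; rewrite num_real].
  move=> [t' C] [/= ft' tC] xyt'.
  by apply: le_trans tC; rewrite ltW// ft'//; exact: xyI.
have [C fC] := filter_ex fN.
by exists C => t; exact: fC.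
Qed.

(** As [I] is open, [- f] extended by [-oo] is lower semicontinuous on the whole line: outside [I]
    no real number lies below the value, so nothing has to be checked there. *)
Lemma usc_measurable (R : realType) (I : set R) (f : R -> R) :
  open I -> upper_semicontinuous_on I f -> measurable_fun I f.
Proof.
move=> oI fusc.
pose g := (fun x => if x \in I then (- f x)%:E else -oo%E).
have mg : measurable_fun setT g.
  apply: lower_semicontinuous_measurable => x a; rewrite /g.
  case: ifPn => // /set_mem Ix; rewrite lte_fin ltrNr => /(fusc _ Ix) fxa.
  exists [set t | I t /\ f t < - a].
    have nI : nbhs x I by exact: open_nbhs_nbhs.
    apply: (@filterS2 _ (nbhs x) _ (fun t => I t -> f t < - a) I) fxa nI.
    by move=> t ft It; split => //; exact: ft.
  by move=> t [It ft]; rewrite (mem_set It) lte_fin ltrNr.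
have mI := open_measurable oI.
apply/measurable_EFinP.
apply: (@eq_measurable_fun _ _ _ _ _ (fun x => - g x)%E).
  by move=> x xI; rewrite /g xI/= opprK.
by apply: measurableT_comp => //; exact: measurable_funTS.
Qed.

(** The inequality is strict because an open [I] contains some [y + e] beyond [y]. *)
Lemma itv_length_gt (R : realType) (I : set R) (x y : R) :
  open I -> I x -> I y -> ((y - x)%:E < itv_length I)%E.
Proof.
move=> oI Ix Iy.
have [e /= e0 ye] : exists2 e : R, 0 < e & I (y + e).
  have /nbhs_ballP[e /= e0 ball_e] := open_nbhs_nbhs (conj oI Iy).
  exists (e / 2); first by rewrite divr_gt0.
  apply: ball_e; rewrite /ball/= opprD addNKr normrN gtr0_norm ?divr_gt0//.
  by rewrite ltr_pdivrMr// ltr_pMr// ltr1n.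
apply: (@lt_le_trans _ _ ((y + e)%:E - x%:E)%E).
  by rewrite -EFinB lte_fin; lra.
apply: leeB; [apply: ereal_sup_ubound|apply: ereal_inf_lbound] => /=.
- by exists (y + e).
- by exists x.
Qed.

(** * Application to the reflected function [k] *)

Theorem theorem5p5 (R : realType) (I : set R) (Psi Phi f : R -> R)
  (I_itv : open_interval I)
  (Psi_ge0 : forall t, co_itv (itv_length I) t -> 0 <= Psi t)
  (Psi_int : locally_integrable_on (co_itv (itv_length I))
               (fun t => Psi t / t))
  (Phi_ge0 : forall t, co_itv (itv_length I) t -> 0 <= Phi t)
  (Phi_def : forall u, 0 < u -> (u%:E < itv_length I)%E ->
    ((Phi u)%:E =
      (Psi u)%:E + lebesgue_int (fun t => (Psi t / t)%R) 0%R u)%E)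
  (f_usc : upper_semicontinuous_on I f)
  (f_ineq : forall u v, I u -> I v -> u < v ->
    ((f u)%:E <=
      ((v - u)^-1)%:E * lebesgue_int f u v + (Psi (v - u)%R)%:E)%E) :
  monotone_up_to I Phi f.
Proof.
have [itvI oI _] := I_itv.
move=> x y Ix Iy; rewrite le_eqVlt => /predU1P[->|xy].
  rewrite subrr lerDl; apply: Phi_ge0; split => //.
  by have := itv_length_gt _ _ _ _ oI Iy Iy; rewrite subrr.
have LI := itv_length_gt _ _ _ _ oI Ix Iy.
have L0 : 0 < y - x by rewrite subr_gt0.
set L := y - x in LI L0 *.
have xyI : `[x, y] `<=` I.
  by move=> t /=; rewrite in_itv/=; exact: itvI.
have yI t : 0 <= t -> t <= L -> I (y - t).
  by move=> t0 tL; apply: xyI; rewrite /= in_itv/=; move: tL; rewrite /L; lra.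
have [C fC] := usc_bounded_above _ _ _ _ _ f_usc xyI.
have Cf t : 0 <= t -> t <= L -> f (y - t) <= C.
  by move=> t0 tL; apply: fC; rewrite in_itv/=; move: tL; rewrite /L; lra.
have mf := usc_measurable _ _ _ oI f_usc.
have mI := open_measurable oI.
(* The value 0 outside [[0, L]] makes [k] nonnegative and Borel measurable on the whole line. *)
pose k := (fun s => C - f (y - s)) \_ `[0, L].
have kE s : 0 <= s -> s <= L -> k s = C - f (y - s).
  by move=> s0 sL; rewrite /k patchE mem_setE in_itv/= s0 sL.
have k0 s : 0 <= k s.
  rewrite /k patchE mem_setE in_itv/=; case: ifP => // /andP[s0 sL].
  by rewrite subr_ge0 Cf.
have mk : measurable_fun setT k.
  apply/(measurable_restrictT _ _).1 => //; apply: measurable_funB => //.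
  apply: (measurable_comp (F := I)) => //.
    by move=> _ [s /= + <-]; rewrite in_itv/= => /andP[s0 sL]; exact: yI.
  by apply: measurable_funB.
(* The number [r] is the integral of [f] over [[y - t, y]], which has to be shown finite before it
   can be subtracted from [C * t]. *)
have key t : 0 < t -> t <= L -> exists r : R,
    f (y - t) <= t^-1 * r + Psi t /\
    (\int[leb]_(s in `[0%R, t]) (k s)%:E = (C * t - r)%:E)%E.
  move=> t0 tL; have t0' := ltW t0.
  have Iyt := yI t t0' tL.
  have fyt : y - t < y by rewrite ltrBlDr ltrDl.
  have := f_ineq _ _ Iyt Iy fyt; rewrite subKr.
  rewrite /lebesgue_int; set D := `[y - t, y]%classic => ft.
  have DI : D `<=` I.
    apply: subset_trans xyI; apply: subset_itvr; rewrite bnd_simp.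
    by move: tL; rewrite /L; lra.
  have fCD z : D z -> f z <= C.
    rewrite /D/= in_itv/= => /andP[z1 z2]; apply: fC; rewrite in_itv/= z2 andbT.
    by move: tL; rewrite /L; lra.
  have mfD : measurable_fun D f by exact: measurable_funS mf.
  have mD : measurable D by exact: measurable_itv.
  have mD' := completed_measurable _ _ mD.
  have mfD' := measurable_fun_completed _ _ _ _ _ mD mfD.
  have DE : cleb D = t%:E.
    rewrite -[LHS]/(leb D) /D lebesgue_measure_itv/= lte_fin fyt -EFinB.
    by rewrite subKr.
  have Dfin : (cleb D < +oo)%E by rewrite DE ltry.
  (* With integral [-oo] the right side of the hypothesis would be [-oo], yet it bounds the real
     number [f (y - t)] from above. *)
  have intNy : (-oo < \int[cleb]_(z in D) (f z)%:E)%E.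
    rewrite ltNye; apply/eqP => intE; move: ft; rewrite intE.
    by rewrite gt0_muleNy ?lte_fin ?invr_gt0.
  have fint := integrable_le_cst _ _ _ cleb _ _ _ mD' Dfin mfD' fCD intNy.
  have /fineK rE := integrable_fin_num mD' fint.
  exists (fine (\int[cleb]_(z in D) (f z)%:E)); split.
    by rewrite -lee_fin EFinD EFinM rE.
  rewrite EFinB rE.
  transitivity (\int[leb]_(s in `[0%R, t]) (C - f (y - s))%R%:E)%E.
    apply: eq_integral => s; rewrite mem_setE in_itv/= => /andP[s0 st].
    by rewrite kE// (le_trans st).
  rewrite -(ge0_integral_completed_reflect _ y 0 t (fun z => C - f z)) ?subr0;
    last 2 first.
  - by apply: measurable_funB.
  - by move=> z Dz; rewrite subr_ge0 fCD.
  have cint : cleb.-integrable D (EFin \o cst C).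
    apply/integrableP; split; first by apply: (measurable_cst C%:E).
    by rewrite -[X in integral _ _ X]/(cst `|C|%:E) integral_cst// lte_mul_pinfty.
  have -> := integralB_EFin mD' cint fint.
  congr (_ - _)%E; rewrite EFinM -DE.
  exact: (integral_cst cleb mD' C%:E).
have Kle t : 0 < t -> t <= L ->
    ((t^-1)%:E * \int[leb]_(s in `[0%R, t]) (k s)%:E <= (k t + Psi t)%R%:E)%E.
  move=> t0 tL; have [r [fr ->]] := key t t0 tL.
  rewrite -EFinM lee_fin mulrBr mulrCA mulVf ?gt_eqF// mulr1 kE ?(ltW t0)//.
  by move: fr; lra.
have [r [fr KE]] := key L L0 (lexx L).
have LE : y - L = x by rewrite /L subKr.
rewrite LE in fr.
(* The slack [d] pays for upper semicontinuity at [y], which yields [f (y - s) <= f y + d] only for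
   [s] up to some [e] depending on [d]. *)
apply/ler_addgt0Pr => d d0.
have [e [e0 eL fe]] : exists e, [/\ 0 < e, e <= L &
    forall s, 0 <= s -> s <= e -> f (y - s) <= f y + d].
  have := f_usc y Iy (f y + d); rewrite ltrDl => /(_ d0) fnear.
  have /nbhs_ballP[e /= e0 ball_e] :
      nbhs y (fun t => I t -> f t < f y + d) by exact: fnear.
  (* Halving puts the closed range of [s] inside the open ball; the minimum with [L] keeps [y - s]
     in [I]. *)
  exists (Num.min L (e / 2)); split.
  - by rewrite lt_min L0 divr_gt0.
  - by rewrite ge_min lexx.
  - move=> s s0; rewrite le_min => /andP[sL se].
    apply: ltW; apply: ball_e; last exact: yI.
    rewrite /ball/= subKr ger0_norm// (le_lt_trans se)//.
    by rewrite ltr_pdivrMr// ltr_pMr// ltr1n.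
have PsiI : lebesgue_integrable_on (fun t => Psi t / t) 0 L.
  apply: Psi_int; first exact: ltW.
  move=> t /=; rewrite in_itv/= => /andP[t0 tL]; split => //.
  by apply: le_lt_trans LI; rewrite lee_fin.
have Psi0 t : 0 <= t -> t <= L -> 0 <= Psi t.
  move=> t0 tL; apply: Psi_ge0; split => //.
  by apply: le_lt_trans LI; rewrite lee_fin.
have Klt : (\int[leb]_(s in `[0%R, L]) (k s)%:E < +oo)%E by rewrite KE ltry.
have ck s : 0 <= s -> s <= e -> C - f y - d <= k s.
  move=> s0 se; rewrite kE//; last exact: le_trans se eL.
  by have := fe s s0 se; lra.
have := le_mean_add_integral _ k Psi _ e L e0 eL mk k0 ck Psi0 PsiI Klt Kle.
rewrite KE; have := Phi_def L L0 LI.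
(* [Phi L] is real, so the integral [P] is finite and [Phi L = Psi L + P]. Adding
   [C - f y - d <= C - r / L + P] to [f x <= r / L + Psi L] makes [C] and [r] disappear. *)
case: (lebesgue_int _ 0 L) => [P| |] //= [->].
rewrite -EFinM -EFinD lee_fin mulrBr mulrCA mulVf ?gt_eqF// mulr1.
by move: fr; lra.
Qed.
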